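(* Let $(\mathfrak{g},\langle\,,\rangle)$ be a semi-symmetric Lorentzian Lie algebra and let $\mathfrak{g}=\mathfrak{g}_0\oplus\mathfrak{g}_1\oplus\dots\oplus\mathfrak{g}_r$ be its orthogonal splitting, where $\mathfrak{g}_0=\ker(\mathrm{Ric}^2)$ and $\mathfrak{g}_1,\dots,\mathfrak{g}_r$ are the eigenspaces associated to the distinct nonzero eigenvalues of $\mathrm{Ric}$. Then, for every $i\in\{1,\dots,r\}$ and every $j\in\{1,\dots,r\}$ with $j\neq i$, $$\mathfrak{g}_j.\mathfrak{g}_i\subset\mathfrak{g}_i,$$ and for every $i\in\{1,\dots,r\}$, $$\mathfrak{g}_i.\mathfrak{g}_i\subset\mathfrak{g}_0+\mathfrak{g}_i,\quad \mathfrak{g}_0.\mathfrak{g}_i\subset\mathfrak{g}_i,\quad \mathfrak{g}_0.\mathfrak{g}_0\subset\mathfrak{g}_0,\quad \mathfrak{g}_i.\mathfrak{g}_0\subset\mathfrak{g}_0+\mathfrak{g}_i.$$ Moreover, if $\dim\mathfrak{g}_0=1$, then for every $u\in\mathfrak{g}_0$, $u.u=0$ and, for every integer $k\geq1$, $[\mathrm{R}_u^k,\mathrm{L}_u]=k\,\mathrm{R}_u^{k+1}$. In particular, $\mathrm{R}_u$ is a nilpotent endomorphism.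
   Context: A Lorentzian Lie algebra is a finite-dimensional real Lie algebra $\mathfrak{g}$ with a nondegenerate inner product of signature $(1,n-1)$. Its Levi-Civita product $u.v=\mathrm{L}_uv$ is defined by $2\langle \mathrm{L}_uv,w\rangle=\langle[u,v],w\rangle+\langle[w,u],v\rangle+\langle[w,v],u\rangle$; right multiplication is $\mathrm{R}_uv=\mathrm{L}_vu=v.u$. The curvature is $K(u,v)=\mathrm{L}_{[u,v]}-[\mathrm{L}_u,\mathrm{L}_v]$, and the Ricci operator is defined by $\langle\mathrm{Ric}(u),v\rangle=\mathrm{tr}(a\mapsto K(u,a)v)$. The Lie algebra is semi-symmetric if $[K(u,v),K(a,b)]=K(K(u,v)a,b)+K(a,K(u,v)b)$ for all $u,v,a,b\in\mathfrak{g}$; in that case all eigenvalues of $\mathrm{Ric}$ are real and $\mathfrak{g}$ splits orthogonally as in the statement. For subspaces $A,B$, $A.B$ denotes the span of the products $a.b$ with $a\in A$, $b\in B$. *)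

(* Defs.v *)
From HB Require Import structures.
From mathcomp Require Import all_boot all_order all_algebra.
From mathcomp Require Import boolp classical_sets reals.
From mathcomp Require Import ring.

Set Implicit Arguments.
Unset Strict Implicit.
Unset Printing Implicit Defensive.
Import Order.TTheory GRing.Theory Num.Theory passmx.
Local Open Scope ring_scope.
Local Open Scope classical_set_scope.

Section LinearEndomorphisms.
Variables (R : realType) (V : vectType R).
Implicit Types f h : 'End(V).

Definition lftrace f : R := \tr (mxof (vbasis {:V}) (vbasis {:V}) f).

Definition lfcomm f h : 'End(V) := (f \o h)%VF - (h \o f)%VF.

(* 'End(V) carries no canonical ring structure, hence no [^+]. *)
Definition lfexp f (k : nat) : 'End(V) := iter k (comp_lfun f) \1%VF.

Definition lfnilpotent f : Prop := exists m, lfexp f m = 0.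

End LinearEndomorphisms.

Section LorentzianLieAlgebras.
Variables (R : realType) (g : vectType R).

Definition is_lie_bracket (br : {bilinear g -> g -> g}) : Prop :=
  (forall u, br u u = 0) /\
  (forall u v w, br u (br v w) + br v (br w u) + br w (br u v) = 0).

(* Signature (1, n-1), n = \dim g, in the form (-,+,...,+). *)
Definition is_lorentzian (ip : {symmetric g}) : Prop :=
  nondegenerate ip /\
  exists e : (\dim {:g}).-tuple g, basis_of {:g} e /\
  exists i0 : 'I_(\dim {:g}), forall i j : 'I_(\dim {:g}),
    ip (tnth e i) (tnth e j) =
      if i == j then (if i == i0 then -1 else 1) else 0.

Variables (ip : {symmetric g}) (br : {bilinear g -> g -> g}).

(* [xget 0 A] is the element of the singleton A (see levi_civita_mulP); the
   default value 0 is irrelevant as soon as ip is nondegenerate. *)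
Definition levi_civita_mul (u v : g) : g :=
  xget 0 [set x | forall w,
    2 * ip x w = ip (br u v) w + ip (br w u) v + ip (br w v) u].

Definition Lmul (u : g) : 'End(g) := linfun (fun v => levi_civita_mul u v).

Definition Rmul (u : g) : 'End(g) := linfun (fun v => Lmul v u).

Definition curvature (u v : g) : 'End(g) :=
  Lmul (br u v) - lfcomm (Lmul u) (Lmul v).

(* Same encoding as for the Levi-Civita product, see ricciP. *)
Definition ricci : 'End(g) :=
  linfun (fun u => xget 0 [set x | forall v,
    ip x v = lftrace (linfun (fun a => curvature u a v))]).

Definition semisymmetric : Prop := forall u v a b : g,
  lfcomm (curvature u v) (curvature a b) =
    curvature (curvature u v a) b + curvature a (curvature u v b).

(* The span of the products a.b with a in A and b in B; by bilinearity it is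
   enough to take a and b in bases, see mulspP. *)
Definition mulsp (A B : {vspace g}) : {vspace g} :=
  <<[seq Lmul a b | a <- vbasis A, b <- vbasis B]>>%VS.

Lemma representable (phi : g -> R) : nondegenerate ip -> scalar phi ->
  exists x, forall w, ip x w = phi w.
Proof.
move=> nd phil.
pose phiL : {scalar g} := HB.pack phi (GRing.isLinear.Build R g R *%R phi phil).
pose b := vbasis {:g}.
pose M := \matrix_(i, j) ip (tnth b i) (tnth b j).
have Munit : M \in unitmx.
  rewrite -row_free_unit -kermx_eq0; apply/eqP/row_matrixP => i.
  rewrite row0; set c := row i _.
  have cM : c *m M = 0 by rewrite /c -row_mul mulmx_ker row0.
  move: c cM => c cM.
  pose x := \sum_j c 0 j *: tnth b j.
  have xj j : ip x (tnth b j) = 0.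
    rewrite /x linear_sumlz; transitivity ((c *m M) 0 j); last by rewrite cM mxE.
    by rewrite mxE; apply: eq_bigr => k _; rewrite linearZl_LR [M _ _]mxE.
  have x0 : x = 0.
    apply/eqP; rewrite -memv0; move: nd => /eqP <-.
    apply/mem_orthovP => v /coord_vbasis ->.
    rewrite linear_sumr big1 // => j _.
    by rewrite linearZr_LR /= -tnth_nth xj mulr0.
  have /freeP bfree : free b := basis_free (vbasisP _).
  apply/rowP => j; rewrite [RHS]mxE; apply: (bfree (fun k => c 0 k)).
  by rewrite -[RHS]x0 /x; apply: eq_bigr => k _; rewrite (tnth_nth 0).
pose c := (\row_j phi (tnth b j)) *m invmx M.
have cM : c *m M = \row_j phi (tnth b j) by rewrite mulmxKV.
exists (\sum_j c 0 j *: tnth b j) => w.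
rewrite [w](coord_vbasis (memvf w)) linear_sumr /=.
rewrite -[phi]/(phiL : g -> R) linear_sum; apply: eq_bigr => j _.
rewrite linearZr_LR linearZ_LR /= -tnth_nth; congr (_ * _).
transitivity ((c *m M) 0 j); last by rewrite cM mxE.
rewrite linear_sumlz mxE; apply: eq_bigr => k _.
by rewrite linearZl_LR [M _ _]mxE.
Qed.

Hypothesis nd : nondegenerate ip.

Lemma ip_inj (x y : g) : (forall w, ip x w = ip y w) -> x = y.
Proof.
move=> xy; apply/eqP; rewrite -subr_eq0 -memv0; move: nd => /eqP <-.
apply/mem_orthovP => v _; rewrite linearBl; apply/eqP.
by rewrite subr_eq0; apply/eqP/xy.
Qed.

Let ipPl a x y z : ip (a *: x + y) z = a * ip x z + ip y z.
Proof. exact: linearPl. Qed.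
Let ipPr a x y z : ip z (a *: x + y) = a * ip z x + ip z y.
Proof. exact: linearPr. Qed.
Let brPl a x y z : br (a *: x + y) z = a *: br x z + br y z.
Proof. exact: linearPl. Qed.
Let brPr a x y z : br z (a *: x + y) = a *: br z x + br z y.
Proof. exact: linearPr. Qed.
Let bilE := (ipPl, ipPr, brPl, brPr).

Lemma levi_civita_mulP (u v w : g) :
  2 * ip (levi_civita_mul u v) w =
    ip (br u v) w + ip (br w u) v + ip (br w v) u.
Proof.
move: w; rewrite /levi_civita_mul; case: xgetP => [x _ //|noex].
pose phi w : R :=
  2^-1 * (ip (br u v) w + ip (br w u) v + ip (br w v) u).
have phil : scalar phi.
  by move=> a y z; rewrite /phi !bilE; ring.
have [x xP] := representable nd phil.
exfalso; apply: (noex x) => w; rewrite xP /phi mulrA divff ?mul1r //.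
by rewrite pnatr_eq0.
Qed.

Let two_neq0 : (2 : R) != 0. Proof. by rewrite pnatr_eq0. Qed.

Lemma levi_civita_mul_linearr (u : g) : linear (levi_civita_mul u).
Proof.
move=> a x y; apply: ip_inj => w.
apply: (mulfI two_neq0); rewrite ipPl mulrDr mulrCA.
by rewrite !levi_civita_mulP !bilE; ring.
Qed.

Lemma levi_civita_mul_linearl (v : g) : linear (levi_civita_mul ^~ v).
Proof.
move=> a x y; apply: ip_inj => w.
apply: (mulfI two_neq0); rewrite ipPl mulrDr mulrCA.
by rewrite !levi_civita_mulP !bilE; ring.
Qed.

Lemma linfunE (f : g -> g) : linear f -> linfun f =1 f.
Proof.
move=> fl x; pose fL : {linear g -> g} :=
  HB.pack f (GRing.isLinear.Build R g g *:%R f fl).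
by rewrite -[f]/(fL : g -> g) lfunE.
Qed.

Lemma LmulE (u v : g) : Lmul u v = levi_civita_mul u v.
Proof. by rewrite linfunE //; apply: levi_civita_mul_linearr. Qed.

Lemma RmulE (u v : g) : Rmul u v = Lmul v u.
Proof.
rewrite linfunE // => a x y; rewrite !LmulE.
exact: levi_civita_mul_linearl.
Qed.

Lemma Lmul_linear : linear Lmul.
Proof.
move=> a x y; apply/lfunP => v.
by rewrite add_lfunE scale_lfunE !LmulE levi_civita_mul_linearl.
Qed.

Lemma curvatureE (u v w : g) :
  curvature u v w = Lmul (br u v) w - (Lmul u (Lmul v w) - Lmul v (Lmul u w)).
Proof.
by rewrite /curvature /lfcomm !(add_lfunE, opp_lfunE, comp_lfunE).
Qed.

Lemma curvature_linearr (u v : g) : linear (fun a => curvature u a v).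
Proof.
move=> a x y; rewrite !curvatureE brPr !Lmul_linear.
rewrite !(add_lfunE, scale_lfunE) linearP !scalerBr.
by rewrite [RHS]addrACA -opprD [in RHS]addrACA -opprD.
Qed.

Lemma curvature_linearl (v : g) : linear (curvature ^~ v).
Proof.
move=> a x y; apply/lfunP => w; rewrite [RHS]add_lfunE [in RHS]scale_lfunE !curvatureE.
rewrite brPl !Lmul_linear !(add_lfunE, scale_lfunE) linearP !scalerBr.
by rewrite [RHS]addrACA -opprD [in RHS]addrACA -opprD.
Qed.

Lemma ricciP (u v : g) :
  ip (ricci u) v = lftrace (linfun (fun a => curvature u a v)).
Proof.
pose T (w z : g) := lftrace (linfun (fun a => curvature w a z)).
have linE w y z : linfun (fun a => curvature w a y) z = curvature w z y.
  by rewrite linfunE //; apply: curvature_linearr.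
have lftraceP c f h : lftrace (c *: f + h) = c * lftrace f + lftrace h.
  by rewrite /lftrace !linearP.
have TPr c x y w : T w (c *: x + y) = c * T w x + T w y.
  rewrite /T -lftraceP; congr lftrace; apply/lfunP => z.
  rewrite [RHS]add_lfunE [in RHS]scale_lfunE !linE.
  by rewrite linearP.
have TPl c x y w : T (c *: x + y) w = c * T x w + T y w.
  rewrite /T -lftraceP; congr lftrace; apply/lfunP => z.
  rewrite [RHS]add_lfunE [in RHS]scale_lfunE !linE.
  by rewrite curvature_linearl [LHS]add_lfunE [in LHS]scale_lfunE.
pose ric w := xget 0 [set x | forall z, ip x z = T w z].
have ricP w z : ip (ric w) z = T w z.
  move: z; rewrite /ric; case: xgetP => [x _ //|noex].
  have Tl : scalar (T w) by move=> c x y; apply: TPr.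
  by have [x xP] := representable nd Tl; case: (noex x).
rewrite -/(T u v) -ricP; congr (ip _ v); apply: linfunE => c x y.
by apply: ip_inj => w; rewrite ipPl !ricP TPl.
Qed.

Lemma mulspP (A B C : {vspace g}) :
  reflect {in A & B, forall a b, Lmul a b \in C} (mulsp A B <= C)%VS.
Proof.
apply: (iffP idP) => [sAB a b /coord_vbasis -> /coord_vbasis -> | sAB].
  rewrite linear_sum; apply: memv_suml => j _; rewrite linearZ memvZ //=.
  rewrite -RmulE linear_sum; apply: memv_suml => i _; rewrite linearZ memvZ //=.
  rewrite RmulE; apply: (subvP sAB).
  apply: memv_span; apply/allpairsP.
  by exists ((vbasis A)`_i, (vbasis B)`_j); rewrite !memt_nth.
apply/span_subvP => _ /allpairsP[[a b] /= [Aa Bb ->]].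
by rewrite sAB ?vbasis_mem.
Qed.

End LorentzianLieAlgebras.

(* Main.v *)
(* Semi-symmetry makes [A = Ric] commute with every [K(u,v)]; with the first Bianchi identity this
   gives [K(Au,v) = A K(u,v) = K(u,v) A], and the same for every polynomial [f] in [A]. Since
   [<A f u, v>] is the trace of [a |-> f (K(u,a)v)], which is nilpotent as soon as a power of [f]
   kills [u], one gets [A f u = 0] in that case. Hence [A - lam] (for [lam <> 0]), [A^2] and
   [A^2 (A - lam)] each have a kernel complementary to their image, and the orthogonal projector
   [e] onto the image still satisfies [K(eu,v) = e K(u,v)].
   If [A] is injective on [im e], the second Bianchi identity at [k, e v, e w], applied to [b] with
   [e k = e b = 0], reduces to [K(ev,ew)(k.b) = - K([ev,ew],k)b], whose two sides lie in [im e]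
   and [ker e]. So both vanish, whence [e (k.b) = 0], and by skew-symmetry [k . im e] lies in
   [im e]. The inclusions follow by taking for [e] the projectors onto the images of [A^2] and
   [A^2 (A - lam)] and onto the kernel of [A - lam]. *)
Require Import Defs.
From HB Require Import structures.
From mathcomp Require Import all_boot all_order all_algebra.
From mathcomp Require Import boolp reals.
From mathcomp Require Import ring lra.
Import GRing.Theory Num.Theory passmx.
Set Implicit Arguments.
Unset Strict Implicit.
Unset Printing Implicit Defensive.
Local Open Scope ring_scope.

(* Rank factorization: for [A = C D], [A^(m+1) = C (D C)^m D], so [D C] has lower nilpotency
   order and the same trace. *)
Lemma mxtrace_nilpotent (F : fieldType) m n (A : 'M[F]_n) :
  iter m (mulmx^~ A) 1%:M = 0 -> \tr A = 0.
Proof.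
elim: m n A => [|m IH] n A /= A0; first by rewrite -[A]mulmx1 A0 mulmx0 linear0.
have [r [C [D [AE fullC freeD]]]] : exists r (C : 'M_(n, r)) (D : 'M_(r, n)),
    [/\ C *m D = A, row_full C & row_free D].
  exists (\rank A), (col_base A), (row_base A).
  by rewrite mulmx_base col_base_full row_base_free.
have iterA k : iter k (mulmx^~ A) 1%:M *m C = C *m iter k (mulmx^~ (D *m C)) 1%:M.
  elim: k => [|k IHk] /=; first by rewrite mul1mx mulmx1.
  by rewrite mulmxA -IHk -!mulmxA (mulmxA C) AE.
rewrite -AE mxtrace_mulC; apply: IH.
apply: (row_full_inj fullC); apply: (row_free_inj freeD).
by rewrite -iterA -mulmxA AE A0 mulmx0 mul0mx.
Qed.

(* Let [p = X^m q], [q(0) <> 0], be the minimal polynomial of [A]. As the commutator of [p(A)]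
   and [B] is [A^2 p'(A)], [p] divides [X^2 p'], hence [q] divides [q'] and [q] is constant. *)
Lemma nilpotent_of_commutator (F : numFieldType) n (A B : 'M[F]_n) :
  A *m B - B *m A = A *m A -> exists m, iter m (mulmx^~ A) 1%:M = 0.
Proof.
case: n A B => [|n] A B comAB; first by exists 0%N; apply: thinmx0.
have comp p : horner_mx A p * B - B * horner_mx A p = A ^+ 2 * horner_mx A p^`().
  elim/poly_ind: p => [|p c IH].
    by rewrite deriv0 !linear0 mul0r mulr0 subrr mulr0.
  rewrite derivD derivM derivX derivC addr0 mulr1 !rmorphD !rmorphM /= horner_mx_X horner_mx_C.
  set P := horner_mx A p in IH *; set P' := horner_mx A p^`() in IH *.
  have PA : P * A = A * P by apply: comm_horner_mx.
  have cB : c%:M * B = B * c%:M by rewrite -[LHS]scalar_mxC.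
  have AB : A * B = A * A + B * A by rewrite -[A * A]comAB subrK.
  rewrite mulrDl mulrDr cB opprD addrACA subrr addr0.
  have PB : P * B = A ^+ 2 * P' + B * P by rewrite -IH subrK.
  have PAA : P * A * A = A ^+ 2 * P by rewrite PA -mulrA PA mulrA.
  rewrite -mulrA AB mulrDr !mulrA PB mulrDl PAA addrA addrK.
  by rewrite mulrDr mulrA addrC.
pose p := mxminpoly A.
have p0 : p != 0 by apply: monic_neq0; apply: mxminpoly_monic.
have pA : horner_mx A p = 0 by apply: mx_root_minpoly.
have dvd_p : p %| 'X^2 * p^`().
  apply: mxminpoly_min; rewrite rmorphM rmorphXn /= horner_mx_X.
  by rewrite -comp pA mul0r mulr0 subrr.
have [m [q q0 pE]] := multiplicity_XsubC p 0.
rewrite p0 /= in q0; rewrite subr0 in pE.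
have q_neq0 : q != 0 by apply: contraNneq q0 => ->; rewrite root0.
have cop k : coprimep q 'X^k.
  by rewrite coprimep_expr // -['X]subr0 -polyC0 coprimep_XsubC // coprimep_sym.
have : q %| q^`().
  rewrite -(@Gauss_dvdpr _ _ 'X^(m + 2)) //; move: dvd_p; rewrite pE derivM mulrDr => dvd_p.
  have : q %| 'X^2 * (q^`() * 'X^m) + 'X^2 * (q * ('X^m)^`()).
    by apply: dvdp_trans dvd_p; apply: dvdp_mulr.
  rewrite dvdp_addl; first by rewrite mulrC -mulrA -exprD mulrC.
  by rewrite mulrCA dvdp_mulr.
move/dvdp_leq => dvd_q.
have q'0 : q^`() = 0.
  apply/eqP; apply: contraLR (lt_size_deriv q_neq0) => /dvd_q.
  by rewrite -leqNgt.
have qC : q = (q`_0)%:P.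
  apply/polyP; case=> [|i]; rewrite coefC //=.
  have := congr1 (fun r : {poly F} => r`_i) q'0; rewrite coef_deriv coef0 => /eqP.
  by rewrite mulrn_eq0 => /eqP.
exists m; move: pA; rewrite pE qC mul_polyC linearZ rmorphXn /= horner_mx_X.
move/eqP; rewrite scaler_eq0 => /orP[/eqP q00|/eqP Am].
  by move: q_neq0; rewrite qC q00 polyC0 eqxx.
rewrite -[RHS]Am; elim: m {pE Am dvd_p cop} => [|m IH] //=.
by rewrite IH exprSr.
Qed.

(** * Traces, adjoints and commutators of endomorphisms *)

Section Trace.
Variables (R : realType) (V : vectType R).
Implicit Types f h : 'End(V).

Let b := vbasis {:V}.
Let bP : basis_of {:V} b := vbasisP _.

Lemma mxof_lfexp f k : mxof b b (lfexp f k) = iter k (mulmx^~ (mxof b b f)) 1%:M.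
Proof.
elim: k => [|k IH] /=; first by rewrite mxof1 ?(basis_free bP).
by rewrite (mxof_comp _ _ bP) IH.
Qed.

Lemma lftrace_nilpotent f : lfnilpotent f -> lftrace f = 0.
Proof.
by case=> m f0; apply: (@mxtrace_nilpotent _ m); rewrite -mxof_lfexp f0 linear0.
Qed.

Lemma lfcommE f h x : lfcomm f h x = f (h x) - h (f x).
Proof. by rewrite add_lfunE opp_lfunE !comp_lfunE. Qed.

Lemma lftraceB f h : lftrace (f - h) = lftrace f - lftrace h.
Proof. by rewrite /lftrace !linearB. Qed.

Lemma lftraceC f h : lftrace (f \o h)%VF = lftrace (h \o f)%VF.
Proof. by rewrite /lftrace !(mxof_comp _ _ bP) mxtrace_mulC. Qed.

(** With [x i] the basis dual to [b], both traces expand into the same products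
    [ip (x j) (x i) * ip b_i (h b_j)], because the Gram matrix of the dual basis is symmetric. *)
Lemma lftrace_adjoint (ip : {symmetric V}) f h : nondegenerate ip ->
  (forall x y, ip (f x) y = ip x (h y)) -> lftrace f = lftrace h.
Proof.
move=> nd adj.
have dual i : {x | forall w, ip x w = coord b i w}.
  by apply/cid/(representable nd) => a y z; rewrite linearP.
pose x i := sval (dual i).
have xP i w : ip (x i) w = coord b i w by apply: (svalP (dual i)).
have symip y z : ip y z = ip z y by rewrite hermC expr0 mul1r.
have trE e : lftrace e = \sum_i ip (x i) (e b`_i).
  rewrite /lftrace; apply: eq_bigr => i _.
  by rewrite xP !mxE /= vecof_delta.
have xE i : x i = \sum_j ip (x j) (x i) *: b`_j.
  by rewrite {1}[x i](coord_vbasis (memvf _)); apply: eq_bigr => j _; rewrite xP.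
have -> : lftrace f = \sum_i \sum_j ip (x j) (x i) * ip b`_i (h b`_j).
  rewrite trE; apply: eq_bigr => i _.
  rewrite symip adj {1}xE !linear_sum; apply: eq_bigr => j _.
  by rewrite !linearZ.
rewrite trE exchange_big; apply: eq_bigr => j _ /=.
rewrite [x j in RHS]xE linear_sumlz; apply: eq_bigr => i _.
by rewrite linearZl_LR symip.
Qed.

Lemma lfcomm_lfexp f h k : lfcomm f h = (f \o f)%VF ->
  lfcomm (lfexp f k) h = k%:R *: lfexp f k.+1.
Proof.
move=> comfh; elim: k => [|k IH].
  by apply/lfunP => x; rewrite lfcommE scale0r zero_lfunE !id_lfunE subrr.
apply/lfunP => x; rewrite lfcommE scale_lfunE !comp_lfunE.
have := congr1 (fun e : 'End(V) => e x) IH; rewrite lfcommE scale_lfunE comp_lfunE.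
have := congr1 (fun e : 'End(V) => e (lfexp f k x)) comfh.
rewrite lfcommE comp_lfunE => /(canRL (subrK _)) fh /(canRL (subrK _)) ->.
by rewrite linearD linearZ /= fh addrA addrK -natr1 scalerDl scale1r.
Qed.

Lemma lfnilpotent_of_commutator f h : lfcomm f h = (f \o f)%VF -> lfnilpotent f.
Proof.
move/(congr1 (mxof b b)); rewrite linearB /= !(mxof_comp _ _ bP) => comm.
(* [mxof] acts on row vectors and reverses products, so the matrix of [h] enters with a minus
   sign. *)
have [|m f0] := @nilpotent_of_commutator _ _ (mxof b b f) (- mxof b b h).
  by rewrite mulmxN mulNmx opprK addrC.
by exists m; apply/eqP; rewrite -(mxof_eq0 bP bP) mxof_lfexp f0.
Qed.

End Trace.

(** * Levi-Civita product and symmetries of its curvature *)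

Section LeviCivita.
Variables (R : realType) (g : vectType R).
Variables (br : {bilinear g -> g -> g}) (ip : {symmetric g}).
Hypothesis nd : nondegenerate ip.
Hypothesis hlie : is_lie_bracket br.

Local Notation L := (Lmul ip br).
Local Notation K := (curvature ip br).
Local Notation Ric := (ricci ip br).

Lemma ipC (x y : g) : ip x y = ip y x.
Proof. by rewrite hermC expr0 mul1r. Qed.

Lemma ipZl a (x y : g) : ip (a *: x) y = a * ip x y.
Proof. by rewrite linearZl_LR. Qed.

Lemma ipZr a (x y : g) : ip x (a *: y) = a * ip x y.
Proof. by rewrite linearZr_LR. Qed.

Lemma br_anti (u v : g) : br v u = - br u v.
Proof.
case: hlie => alt _; apply/eqP; rewrite -addr_eq0; apply/eqP.
by have := alt (u + v); rewrite linearDl !linearDr !alt add0r addr0 addrC.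
Qed.

Lemma LDl (u v w : g) : L (u + v) w = L u w + L v w.
Proof. by have := Lmul_linear br nd 1 u v; rewrite !scale1r => ->; rewrite add_lfunE. Qed.

Lemma LZl a (u w : g) : L (a *: u) w = a *: L u w.
Proof.
pose LL : {linear g -> 'End(g)} :=
  HB.pack L (GRing.isLinear.Build R g 'End(g) *:%R L (Lmul_linear br nd)).
by rewrite -[L]/(LL : g -> _) linearZ scale_lfunE.
Qed.

Lemma L0l (w : g) : L 0 w = 0.
Proof. by have := LZl 0 0 w; rewrite !scale0r. Qed.

Lemma LNl (u w : g) : L (- u) w = - L u w.
Proof. by rewrite -scaleN1r LZl scaleN1r. Qed.

Lemma LE (u v w : g) :
  2 * ip (L u v) w = ip (br u v) w + ip (br w u) v + ip (br w v) u.
Proof. by rewrite LmulE // levi_civita_mulP. Qed.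

Lemma two_inj : injective ( *%R (2 : R)).
Proof. by move=> x y; apply: mulfI; rewrite pnatr_eq0. Qed.

Lemma Lmul_skew (u v w : g) : ip (L u v) w = - ip v (L u w).
Proof.
apply: two_inj; rewrite mulrN [ip v _]ipC !LE.
by rewrite (br_anti u v) (br_anti u w) (br_anti v w) !linearNl; ring.
Qed.

Lemma Lmul_torsion (u v : g) : L u v - L v u = br u v.
Proof.
apply: (ip_inj nd) => w; apply: two_inj; rewrite linearBl mulrBr !LE.
by rewrite (br_anti u v) !linearNl; ring.
Qed.

Lemma K_anti (u v : g) : K v u = - K u v.
Proof.
apply/lfunP => w; rewrite opp_lfunE !curvatureE (br_anti u v) LNl.
(* Pairing with an arbitrary [z] turns the vector identity into a scalar one, within reach of
   [ring]. *)
by apply: (ip_inj nd) => z; rewrite !(linearBl, linearNl) /=; ring.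
Qed.

Lemma K_skew (u v a b : g) : ip (K u v a) b = - ip a (K u v b).
Proof.
rewrite !curvatureE !(linearBl, linearBr) /= (Lmul_skew _ a b).
by rewrite !(Lmul_skew _ (L _ a)) !(Lmul_skew _ a) !opprK; ring.
Qed.

(** Vanishing torsion writes [L (br x y) z] as [z.[x,y] - [z,[x,y]]]; the triple products cancel in
    the cyclic sum and Jacobi disposes of the brackets. *)
Lemma bianchi1 (u v w : g) : K u v w + K v w u + K w u v = 0.
Proof.
case: hlie => _ jac.
have tors x y z : L (br x y) z = L z (L x y) - L z (L y x) - br z (br x y).
  by rewrite -(Lmul_torsion z) -linearB /= (Lmul_torsion x) opprB addrC subrK.
rewrite !curvatureE !tors -[RHS]oppr0 -(jac u v w).
apply: (ip_inj nd) => z; rewrite !(linearBl, linearDl, linearNl) /=.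
ring.
Qed.

Lemma K_pair (u v a b : g) : ip (K u v a) b = ip (K a b u) v.
Proof.
have B x y z t : ip (K x y z) t + ip (K y z x) t + ip (K z x y) t = 0.
  by rewrite -!linearDl bianchi1 linear0l.
have N x y z t : ip (K x y z) t = - ip (K y x z) t by rewrite K_anti opp_lfunE linearNl.
have S x y z t : ip (K x y z) t = - ip (K x y t) z by rewrite K_skew ipC.
(* Octahedron argument: four first Bianchi identities, with terms matched by skew-symmetry, combine
   linearly into pair symmetry. *)
have := B u v a b; have := B v a b u; have := B a b u v; have := B b u v a.
have := S u v b a; have := S a b v u; have := S v a b u; have := S b u v a.
have := N a u v b; have := S u a v b; have := N b v a u; have := S v b a u.
lra.
Qed.

Lemma KDl (u v w x : g) : K (u + v) w x = K u w x + K v w x.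
Proof. by have := curvature_linearl br nd w 1 u v; rewrite !scale1r => ->; rewrite add_lfunE. Qed.

Lemma KZl a (u w x : g) : K (a *: u) w x = a *: K u w x.
Proof.
have K0 : K 0 w = 0.
  have := curvature_linearl br nd w 1 0 0; rewrite !scale1r addr0 => /esym/eqP.
  by rewrite -subr_eq0 addrK => /eqP.
by have := curvature_linearl br nd w a u 0; rewrite K0 !addr0 => ->; rewrite scale_lfunE.
Qed.

Lemma KNl (u w x : g) : K (- u) w x = - K u w x.
Proof. by rewrite -scaleN1r KZl scaleN1r. Qed.

Lemma K0l (w x : g) : K 0 w x = 0.
Proof. by have := KZl 0 0 w x; rewrite !scale0r. Qed.

Lemma KNr (u v w : g) : K u v w = - K v u w.
Proof. by rewrite K_anti opp_lfunE. Qed.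

(** Double commutators of the [L] cancel by Jacobi for endomorphisms, and [[L_u, L_[v,w]] =
    L_[u,[v,w]] + K([v,w],u)], where the [L] terms sum to zero by Jacobi in [g]. *)
Lemma bianchi2 (u v w x : g) :
  lfcomm (L u) (K v w) x + lfcomm (L v) (K w u) x + lfcomm (L w) (K u v) x =
  K (br v w) u x + K (br w u) v x + K (br u v) w x.
Proof.
case: hlie => _ jac.
have J : L (br u (br v w)) x + L (br v (br w u)) x + L (br w (br u v)) x = 0.
  by rewrite -!LDl jac L0l.
rewrite !lfcommE !curvatureE.
have N a b c : L (br (br b c) a) x = - L (br a (br b c)) x.
  by rewrite br_anti LNl.
rewrite !N -[RHS]addr0 -{}J {N}.
apply: (ip_inj nd) => z; rewrite !(linearB, linearBl, linearDl, linearNl) /=.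
ring.
Qed.

(** * Self-adjointness and kernel of the Ricci operator *)

Definition rictr (u v : g) : 'End(g) := linfun (fun a => K u a v).

Lemma rictrE (u v a : g) : rictr u v a = K u a v.
Proof. exact: linfunE (curvature_linearr br nd u v) a. Qed.

Lemma ricE (u v : g) : ip (Ric u) v = lftrace (rictr u v).
Proof. exact: ricciP. Qed.

(** Pair symmetry makes [rictr u v] and [rictr v u] adjoint to each other. *)
Lemma Ric_sym (u v : g) : ip (Ric u) v = ip u (Ric v).
Proof.
rewrite [RHS]ipC !ricE; apply: lftrace_adjoint nd _ => a b.
by rewrite !rictrE K_pair ipC.
Qed.

Lemma Ric_eq0 (z : g) : (forall x y, K x y z = 0) -> Ric z = 0.
Proof.
move=> Kz; apply: (ip_inj nd) => v; rewrite linear0l ricE.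
suff -> : rictr z v = 0 by rewrite /lftrace !linear0.
apply/lfunP => a; rewrite rictrE [RHS]lfunE /=; apply: (ip_inj nd) => t.
by rewrite K_pair Kz !linear0l.
Qed.

(** Commutation is imposed in the first slot only; [compat_Kr] and [compat_K] transfer it to the
    other two by antisymmetry and pair symmetry. *)
Definition curvature_compatible (f : 'End(g)) :=
  (forall u v, ip (f u) v = ip u (f v)) /\
  (forall u v w, K (f u) v w = f (K u v w)).

Section Compatible.
Variable f : 'End(g).
Hypothesis fP : curvature_compatible f.

Lemma compat_Kr (u v w : g) : K u (f v) w = f (K u v w).
Proof. by rewrite KNr (proj2 fP) -linearN -KNr. Qed.

Lemma compat_K (u v w : g) : K u v (f w) = f (K u v w).
Proof.
apply: (ip_inj nd) => z.
by case: fP => sym Kf; rewrite K_pair Kf sym K_pair compat_Kr.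
Qed.

End Compatible.

(** * Semi-symmetry and operators compatible with the curvature *)

Hypothesis hss : semisymmetric ip br.

Lemma semisymmetricE (u v a b x : g) :
  K u v (K a b x) - K a b (K u v x) = K (K u v a) b x + K a (K u v b) x.
Proof. by rewrite -lfcommE hss add_lfunE. Qed.

(** By semi-symmetry [rictr (K u v a) w] is [- rictr a (K u v w)] plus a commutator, which has trace
    zero. *)
Lemma Ric_K (u v a : g) : Ric (K u v a) = K u v (Ric a).
Proof.
apply: (ip_inj nd) => w; rewrite K_skew !ricE.
have -> : rictr (K u v a) w =
    (K u v \o rictr a w)%VF - (rictr a w \o K u v)%VF - rictr a (K u v w).
  apply/lfunP => b; rewrite add_lfunE opp_lfunE -/(lfcomm _ _) lfcommE !rictrE.
  by rewrite addrAC semisymmetricE addrK.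
by rewrite !lftraceB lftraceC subrr sub0r.
Qed.

Lemma Ric_compat : curvature_compatible Ric.
Proof.
split=> [|u v w]; first exact: Ric_sym.
have Kl a b c d : ip (K (Ric a) b c) d = ip (K a (Ric b) c) d.
  by rewrite [LHS]K_pair -Ric_K Ric_sym K_pair.
(* First Bianchi identity at [Ric a], [b], [c], with [Ric] moved between the first two slots by
   [Kl]. *)
have F a b c : K (Ric a) b c + K (Ric c) a b = - Ric (K b c a).
  apply/eqP; rewrite -addr_eq0 Ric_K; apply/eqP; rewrite -[RHS](bianchi1 (Ric a) b c).
  rewrite -!addrA; congr (_ + _); rewrite addrC; congr (_ + _).
  by apply: (ip_inj nd) => z; exact: Kl.
apply: (ip_inj nd) => z.
(* The cyclic versions of [F] form a linear system for [K (Ric u) v w] and its cyclic permutations;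
   the first Bianchi identity under [Ric] simplifies its solution. *)
have := congr1 (ip^~ z) (F u v w); have := congr1 (ip^~ z) (F v w u).
have := congr1 (ip^~ z) (F w u v).
have : ip (Ric (K u v w)) z + ip (Ric (K v w u)) z + ip (Ric (K w u v)) z = 0.
  by rewrite -!linearDl -!linearD bianchi1 linear0 linear0l.
rewrite /= !linearDl !linearNl.
lra.
Qed.

Lemma compat_id : curvature_compatible \1%VF.
Proof. by split=> *; rewrite !id_lfunE. Qed.

Lemma compatB f h : curvature_compatible f -> curvature_compatible h ->
  curvature_compatible (f - h).
Proof.
have fhE x : (f - h) x = f x - h x by rewrite add_lfunE opp_lfunE.
move=> [fs fK] [hs hK]; split=> [u v|u v w]; rewrite !fhE.
  by rewrite linearBl linearBr /= fs hs.
by rewrite KDl KNl fK hK.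
Qed.

Lemma compatZ a f : curvature_compatible f -> curvature_compatible (a *: f).
Proof.
have afE x : (a *: f) x = a *: f x by rewrite scale_lfunE.
move=> [fs fK]; split=> [u v|u v w]; rewrite !afE.
  by rewrite ipZl ipZr fs.
by rewrite KZl fK.
Qed.

Lemma compat_comp f h : curvature_compatible f -> curvature_compatible h ->
  (forall x, f (h x) = h (f x)) -> curvature_compatible (f \o h)%VF.
Proof.
move=> [fs fK] [hs hK] fh; split=> [u v|u v w]; rewrite !comp_lfunE.
  by rewrite fs hs fh.
by rewrite fK hK.
Qed.

Lemma Ric_nilpotent f u m : curvature_compatible f -> iter m.+1 f u = 0 ->
  Ric (f u) = 0.
Proof.
move=> fP fu0; apply: (ip_inj nd) => v; rewrite linear0l ricE.
have Kit k b : K u (iter k f b) v = iter k f (K u b v).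
  by elim: k => //= k IH; rewrite compat_Kr // IH.
have Kitl k b : K (iter k f u) b v = iter k f (K u b v).
  by elim: k => //= k IH; rewrite (proj2 fP) IH.
have expE k a : lfexp (rictr (f u) v) k a = iter k f (iter k (fun b => K u b v) a).
  elim: k a => [|k IH] a; first by rewrite /= id_lfunE.
  by rewrite comp_lfunE IH rictrE (proj2 fP) Kit.
apply: lftrace_nilpotent; exists m.+1; apply/lfunP => a.
(* All [m.+1] factors [f] are absorbed by the [u] of the outermost [K u]. *)
by rewrite expE [iter m.+1 (fun b => K u b v) a]/= -Kitl fu0 K0l zero_lfunE.
Qed.

(** * Orthogonal projectors and products of their kernels and images *)

Lemma compat_projector f : curvature_compatible f -> (forall x, f (f x) = 0 -> f x = 0) ->
  exists e : 'End(g), [/\ curvature_compatible e, forall x, e (e x) = e x,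
    forall x, e x = 0 <-> f x = 0 & forall x, e (f x) = f x].
Proof.
move=> fP ff; have [fs fK] := fP.
have cap0 : (limg f :&: lker f = 0)%VS.
  apply/eqP; rewrite -subv0; apply/subvP => _ /memv_capP[/memv_imgP[x _ ->]].
  by rewrite memv_ker => /eqP/ff ->; apply: mem0v.
have sumT : (limg f + lker f)%VS = fullv.
  apply/eqP; rewrite eqEdim subvf dimv_disjoint_sum //= addnC.
  by rewrite -(limg_ker_dim f fullv) capfv.
pose e := daddv_pi (limg f) (lker f).
have eI x : exists z, e x = f z.
  by have /memv_imgP[z _ ->] := memv_pi (limg f) (lker f) x; exists z.
have ef x : e (f x) = f x by apply: daddv_pi_id; rewrite // memv_img ?memvf.
have fe x : f (e x) = f x.
  have xe : e x + daddv_pi (lker f) (limg f) x = x.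
    by apply: daddv_pi_add; rewrite ?sumT ?memvf.
  have /eqP k0 : f (daddv_pi (lker f) (limg f) x) == 0 by rewrite -memv_ker memv_pi.
  by rewrite -[in RHS]xe linearD /= k0 addr0.
have e0 x : e x = 0 <-> f x = 0.
  split=> [ex0|fx0]; first by rewrite -fe ex0 linear0.
  by have [z ez] := eI x; rewrite ez; apply: ff; rewrite -ez fe.
have ee x : e (e x) = e x by have [z ->] := eI x.
exists e; split=> //; split=> [u v|u v w].
  (* [y - e y] lies in the kernel of the self-adjoint [f], which is orthogonal to the image of
     [f]. *)
  have sym x y : ip (e x) y = ip (e x) (e y).
    have [z ->] := eI x; rewrite -[y in LHS](subrK (e y)) linearDr /=.
    by rewrite fs linearB /= fe subrr linear0r add0r.
  by rewrite sym ipC -sym ipC.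
(* [K (e u) v w] lies in the image of [f] and [K (u - e u) v w] in its kernel, so [e] fixes the
   first and kills the second. *)
have [z ez] := eI u; rewrite ez fK -ef -fK -ez.
have -> : K u v w = K (u - e u) v w + K (e u) v w by rewrite -KDl subrK.
rewrite linearD /=; suff -> : e (K (u - e u) v w) = 0 by rewrite add0r.
by apply/e0; rewrite -fK linearB /= fe subrr K0l.
Qed.

Section Projector.
Variable e : 'End(g).
Hypothesis eP : curvature_compatible e.
Hypothesis ee : forall x, e (e x) = e x.
Hypothesis einj : forall x, Ric (e x) = 0 -> e x = 0.

Lemma Lmul_ker_proj (k b : g) : e k = 0 -> e b = 0 -> e (L k b) = 0.
Proof.
move=> k0 b0; have [es eK] := eP.
have Kel w x : K (e w) k x = 0 by rewrite eK -compat_Kr // k0 KNr K0l oppr0.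
have Ker w x : K k (e w) x = 0 by rewrite KNr Kel oppr0.
have Keb v w : K v (e w) b = 0 by rewrite compat_Kr // -compat_K // b0 linear0.
have key v w : e (K (e v) (e w) (L k b)) = 0.
  have E1 : lfcomm (L k) (K (e v) (e w)) b = - K (e v) (e w) (L k b).
    by rewrite lfcommE Keb linear0 sub0r.
  have E2 : lfcomm (L (e v)) (K (e w) k) b = 0.
    by rewrite lfcommE !Kel linear0 subr0.
  have E3 : lfcomm (L (e w)) (K k (e v)) b = 0.
    by rewrite lfcommE !Ker linear0 subr0.
  have := bianchi2 k (e v) (e w) b.
  rewrite E1 E2 E3 (Keb (br (e w) k) v) (Keb (br k (e v)) w) !addr0 => /eqP.
  rewrite eqr_oppLR => /eqP ->.
  by rewrite linearN /= -compat_Kr // k0 KNr K0l !oppr0.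
apply: einj; apply: Ric_eq0 => x y.
(* The idempotent [e] slides between slots, so it can be copied from the last one into the other
   two. *)
have -> : K x y (e (L k b)) = K (e x) (e y) (e (L k b)).
  by rewrite [RHS]eK (compat_Kr eP) !ee -(compat_K eP) ee.
by rewrite compat_K // key.
Qed.

Lemma Lmul_img_proj (k a : g) : e k = 0 -> e (L k (e a)) = L k (e a).
Proof.
move=> k0; have [es eK] := eP; apply: (ip_inj nd) => b; rewrite es.
have perp : ip (L k (e a)) (b - e b) = 0.
  rewrite Lmul_skew es Lmul_ker_proj ?linear0r ?oppr0 //.
  by rewrite linearB /= ee subrr.
by apply/esym/eqP; rewrite -subr_eq0 -linearBr; apply/eqP; exact: perp.
Qed.

End Projector.

(** * Products in the eigenspaces and in the kernel of [Ric^2] *)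

(** The left factor is given as an image so that the projector [e'] onto the eigenspace kills it;
    this covers [g_0] and the other eigenspaces at once. *)
Lemma Lmul_eigenspace lam (z x : g) : lam != 0 ->
  x \in leigenspace Ric lam ->
  L ((Ric - lam *: \1%VF) z) x \in leigenspace Ric lam.
Proof.
rewrite /leigenspace !memv_ker; set f := (Ric - _) => lam0 /eqP fx0.
have fE y : f y = Ric y - lam *: y.
  by rewrite add_lfunE opp_lfunE scale_lfunE id_lfunE.
have fP : curvature_compatible f.
  exact: compatB Ric_compat (compatZ lam compat_id).
have eig0 y : Ric y = 0 -> f y = 0 -> y = 0.
  move=> Ry /eqP; rewrite fE Ry sub0r oppr_eq0 scaler_eq0 (negPf lam0) /=.
  by move/eqP.
have ff y : f (f y) = 0 -> f y = 0.
  (* [Ric_nilpotent] gives [Ric (f y) = 0], and a vector killed by both [Ric] and [Ric - lam] is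
     zero. *)
  by move=> ffy0; apply: eig0 => //; apply: (@Ric_nilpotent _ _ 1).
have [e [eP ee e0 ef]] := compat_projector fP ff.
pose e' := \1%VF - e.
have e'E y : e' y = y - e y by rewrite add_lfunE opp_lfunE id_lfunE.
have eP' : curvature_compatible e' by apply: compatB compat_id eP.
have ee' y : e (e' y) = 0 by rewrite e'E linearB /= ee subrr.
have e'e' y : e' (e' y) = e' y by rewrite {1}e'E ee' subr0.
have inj y : Ric (e' y) = 0 -> e' y = 0 by move/eig0; apply; apply/e0.
have xE : x = e' x by rewrite e'E (proj2 (e0 x) fx0) subr0.
have fz0 : e' (f z) = 0 by rewrite e'E ef subrr.
have Lx := Lmul_img_proj eP' e'e' inj x fz0.
by apply/eqP/e0; rewrite xE -Lx ee'.
Qed.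

(** Serves [q = 1], where the kernel of [e] is [g_0], and [q = Ric - lam_i], where it is
    [g_0 + g_i]. *)
Lemma ker_sqr_projector (q : 'End(g)) : curvature_compatible q ->
  (forall x, Ric (q x) = q (Ric x)) ->
  exists e : 'End(g), [/\ curvature_compatible e, forall x, e (e x) = e x,
    forall x, e x = 0 <-> Ric (Ric (q x)) = 0 & forall x, Ric (e x) = 0 -> e x = 0].
Proof.
move=> qP qR.
pose p := (Ric \o q)%VF; pose f := (Ric \o p)%VF.
have pE x : p x = Ric (q x) by rewrite comp_lfunE.
have fE x : f x = Ric (p x) by rewrite comp_lfunE.
have pP : curvature_compatible p := compat_comp Ric_compat qP qR.
have pR x : Ric (p x) = p (Ric x) by rewrite !pE qR.
have fP : curvature_compatible f := compat_comp Ric_compat pP pR.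
have ff x : f (f x) = 0 -> f x = 0.
  (* [Ric_nilpotent] is applied to [p] rather than [f], since [Ric (p x)] is [f x]; the fourth power
     is needed to recover [f (f x)] inside [p^4 x]. *)
  move=> ffx0; rewrite fE; apply: (@Ric_nilpotent _ _ 3) => //=.
  have -> : p (p (p (p x))) = q (q (f (f x))) by rewrite !fE !pE -!qR.
  by rewrite ffx0 !linear0.
have [e [eP ee e0 _]] := compat_projector fP ff.
exists e; split=> // x; first by rewrite e0 fE pE.
by move=> Rex0; rewrite -ee; apply/e0; rewrite fE pR Rex0 linear0.
Qed.

Lemma Lmul_ker_sqr (q : 'End(g)) (k b : g) : curvature_compatible q ->
  (forall x, Ric (q x) = q (Ric x)) ->
  Ric (Ric (q k)) = 0 -> Ric (Ric (q b)) = 0 -> Ric (Ric (q (L k b))) = 0.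
Proof.
move=> qP qR /= k0 b0; have [e [eP ee e0 inj]] := ker_sqr_projector qP qR.
by apply/e0/(Lmul_ker_proj eP ee inj); apply/e0.
Qed.

Lemma Lmul_ker_Ric2 (k b : g) :
  Ric (Ric k) = 0 -> Ric (Ric b) = 0 -> Ric (Ric (L k b)) = 0.
Proof.
have := @Lmul_ker_sqr \1%VF k b compat_id; rewrite !id_lfunE; apply.
by move=> x; rewrite !id_lfunE.
Qed.

(** * The case of a one-dimensional [g_0] *)

(** For [u] nonzero, [g] is the orthogonal sum of the line of [u] and the image of [e], so [u] is
    not isotropic, while [u.u] is both proportional and orthogonal to [u]. For the curvature,
    [K(u, e x) = K(e u, x) = 0]. *)
Lemma ker_Ric2_line (u : g) : \dim (lker (Ric \o Ric)%VF) = 1%N ->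
  Ric (Ric u) = 0 -> L u u = 0 /\ forall x w, K u x w = 0.
Proof.
move=> dim1 Ru; have [->|u0] := eqVneq u 0.
  by split=> [|x w]; rewrite ?L0l ?K0l.
have line x : Ric (Ric x) = 0 -> exists c, x = c *: u.
  move=> Rx; apply/vlineP; suff -> : (<[u]> = lker (Ric \o Ric))%VS.
    by rewrite memv_ker comp_lfunE Rx.
  by apply/eqP; rewrite eqEdim dim1 dim_vline u0 -memvE memv_ker comp_lfunE Ru eqxx.
have id_comm x : Ric (\1%VF x) = \1%VF (Ric x) by rewrite !id_lfunE.
have [e [eP ee e0 _]] := ker_sqr_projector compat_id id_comm.
have {}e0 x : e x = 0 <-> Ric (Ric x) = 0 by rewrite e0 id_lfunE.
have eu : e u = 0 by apply/e0.
have decomp x : exists c, x = c *: u + e x.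
  have [|c xc] := line (x - e x); first by apply/e0; rewrite linearB /= ee subrr.
  by exists c; rewrite -xc subrK.
split=> [|x w].
  have [c Luu] := line _ (Lmul_ker_Ric2 Ru Ru).
  have uu0 : ip (L u u) u = 0 by have := Lmul_skew u u u; rewrite (ipC u) => h; lra.
  have /eqP := uu0; rewrite Luu ipZl mulf_eq0 => /orP[/eqP->|/eqP uu]; first by rewrite scale0r.
  case/negP: u0; apply/eqP/(ip_inj nd) => x; have [d ->] := decomp x.
  by rewrite linear0l linearDr /= ipZr uu mulr0 add0r -(proj1 eP) eu linear0l.
have [d ->] := decomp x; rewrite KNr KDl KZl (proj2 eP) -compat_Kr // eu.
have Kuu : K u u w = 0 by rewrite curvatureE (proj1 hlie) L0l subrr subr0.
by rewrite Kuu scaler0 add0r KNr K0l oppr0 oppr0.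
Qed.

(** Expanding [K u x u = 0] with [[u,x] = u.x - x.u] and [u.u = 0] leaves
    [(u.x).u - u.(x.u) = (x.u).u]. *)
Lemma lfcomm_Rmul_Lmul (u : g) : L u u = 0 -> (forall x w, K u x w = 0) ->
  lfcomm (Rmul ip br u) (L u) = (Rmul ip br u \o Rmul ip br u)%VF.
Proof.
move=> uu Ku; apply/lfunP => x; rewrite lfcommE comp_lfunE !RmulE //.
have := Ku x u; rewrite curvatureE -Lmul_torsion LDl LNl uu linear0 subr0 => /eqP.
by rewrite addrAC subr_eq0 => /eqP.
Qed.

End LeviCivita.

(** * Spectral decomposition and the final inclusions *)

Lemma ker_sqr_sub_eigen (R : realType) (g : vectType R) (f : 'End(g)) (lam : R) (x : g) :
  lam != 0 -> f (f (f x - lam *: x)) = 0 ->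
  x \in (lker (f \o f)%VF + leigenspace f lam)%VS.
Proof.
(* [y] is the eigenspace component of [x]: [f^2] is [lam^2] on the eigenspace and zero on its own
   kernel. *)
move=> lam0 fx; pose y := lam^-1 *: (lam^-1 *: f (f x)).
have fffx : f (f (f x)) = lam *: f (f x).
  by apply/eqP; rewrite -subr_eq0 -fx !linearB !linearZ.
have fy : f y = lam^-1 *: f (f x) by rewrite !linearZ /= fffx scalerK.
have -> : x = (x - y) + y by rewrite subrK.
apply: memv_add; rewrite memv_ker.
  by rewrite comp_lfunE !linearB /= fy linearZ /= fffx scalerK // subrr.
by rewrite add_lfunE opp_lfunE scale_lfunE id_lfunE fy scalerA divff ?scale1r ?subrr.
Qed.

Theorem proposition4p1 (R : realType) (g : vectType R)
  (br : {bilinear g -> g -> g}) (ip : {symmetric g})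
  (hlie : is_lie_bracket br) (hlor : is_lorentzian ip)
  (hss : semisymmetric ip br)
  (r : nat) (lam : 'I_r -> R) (lam_inj : injective lam)
  (lamP : forall a : R,
     (exists i : 'I_r, lam i = a) <-> a != 0 /\ leigenvalue (ricci ip br) a) :
  let g0 := lker (ricci ip br \o ricci ip br)%VF in
  let gs (i : 'I_r) := leigenspace (ricci ip br) (lam i) in
  (forall i j : 'I_r, j != i -> (mulsp ip br (gs j) (gs i) <= gs i)%VS) /\
  (forall i : 'I_r,
     (mulsp ip br (gs i) (gs i) <= g0 + gs i)%VS /\
     (mulsp ip br g0 (gs i) <= gs i)%VS /\
     (mulsp ip br (gs i) g0 <= g0 + gs i)%VS) /\
  (mulsp ip br g0 g0 <= g0)%VS /\
  (\dim g0 = 1%N ->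
     forall u : g, u \in g0 ->
       Lmul ip br u u = 0 /\
       (forall k : nat, (1 <= k)%N ->
          lfcomm (lfexp (Rmul ip br u) k) (Lmul ip br u) =
            k%:R *: lfexp (Rmul ip br u) k.+1) /\
       lfnilpotent (Rmul ip br u)).
Proof.
move=> g0 gs; have nd := proj1 hlor.
pose Ric := ricci ip br.
have g0P x : (x \in g0) = (Ric (Ric x) == 0) by rewrite memv_ker comp_lfunE.
have fE a x : (Ric - a *: \1%VF) x = Ric x - a *: x.
  by rewrite add_lfunE opp_lfunE scale_lfunE id_lfunE.
have gsP i x : (x \in gs i) = (Ric x == lam i *: x).
  by rewrite memv_ker fE subr_eq0.
have lam0 i : lam i != 0 by case: (lamP (lam i)) => + _; case; first by exists i.
(* [g_0 + g_i] is the kernel of [Ric^2 (Ric - lam_i)], and both factors lie in it. *)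
have sum_mul i k b : k \in gs i -> (b \in g0) || (b \in gs i) ->
    Lmul ip br k b \in (g0 + gs i)%VS.
  rewrite gsP => /eqP Rk bP; apply: ker_sqr_sub_eigen => //.
  rewrite -fE; apply: Lmul_ker_sqr => //; rewrite ?fE.
  - apply: compatB => //; first exact: Ric_compat.
    by apply: compatZ => //; apply: compat_id.
  - by move=> x; rewrite !fE linearB linearZ.
  - by rewrite Rk subrr !linear0.
  case/orP: bP; rewrite ?g0P ?gsP => /eqP Rb.
    by rewrite !linearB !linearZ /= Rb !linear0 addr0.
  by rewrite Rb subrr !linear0.
have g0f i k : k \in g0 -> exists z, k = (Ric - lam i *: \1%VF) z.
  (* As [Ric^2 k = 0], the geometric series for the inverse of [Ric - lam_i] stops after two
     terms. *)
  rewrite g0P => /eqP Rk; exists (- ((lam i)^-1 *: (k + (lam i)^-1 *: Ric k))).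
  rewrite fE scalerN opprK linearN linearZ linearD linearZ /=.
  rewrite (linearZ _ (Ric k)) /= Rk scaler0 addr0.
  by rewrite scalerA divff // scale1r scalerN addrC addrK.
split; [|split; [|split]].
- move=> i j ji; apply/mulspP => // u v; rewrite gsP => /eqP Ru vi.
  have lamij : lam j - lam i != 0 by rewrite subr_eq0 (inj_eq lam_inj).
  (* On [g_j] the operator [Ric - lam_i] is the nonzero scalar [lam_j - lam_i], hence onto. *)
  have -> : u = (Ric - lam i *: \1%VF) ((lam j - lam i)^-1 *: u).
    by rewrite linearZ /= fE Ru -scalerBl scalerA mulVf ?scale1r.
  exact: Lmul_eigenspace.
- move=> i; split; [|split]; apply/mulspP => // u v ui vi.
  + by apply: sum_mul; rewrite // vi orbT.
  + by have [z ->] := g0f i u ui; apply: Lmul_eigenspace.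
  + by apply: sum_mul; rewrite // vi.
- apply/mulspP => // u v; rewrite !g0P => /eqP Ru /eqP Rv.
  by apply/eqP/Lmul_ker_Ric2.
move=> dim1 u; rewrite g0P => /eqP Ru.
have [uu Ku] := ker_Ric2_line nd hlie hss dim1 Ru.
have comm := lfcomm_Rmul_Lmul nd hlie uu Ku.
split=> //; split=> [k _|]; first exact: lfcomm_lfexp.
exact: lfnilpotent_of_commutator comm.
Qed.
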